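(* Let $p$ and $m$ be positive integers and let $f:[0,1]\to\mathbb{C}$ be a function having a continuous $m$-th derivative on $[0,1]$. For $x\in[0,1]$ define $$\mathcal{H}_p(f;x)=\frac1p\sum_{k=0}^{p-1}f\left(\frac{k+x}{p}\right),$$ $$\mathcal{E}(p,m,f;x)=\int_0^1f(t)\,dt-\mathcal{H}_p(f;x)+\sum_{k=1}^m\frac{B_k(x)}{k!}\cdot\frac{f^{(k-1)}(1)-f^{(k-1)}(0)}{p^k}.$$ Then, for every $x\in[0,1]$: (i) $\displaystyle \mathcal{E}(p,m,f;x)=\frac{1}{p^m}\int_0^1\frac{\widetilde{B}_m(x-pt)}{m!}f^{(m)}(t)\,dt.$ (ii) $\displaystyle |\mathcal{E}(p,m,f;x)|\le\frac{8}{\pi}\cdot\frac{1}{(2\pi p)^m}\cdot\sup_{[0,1]}|f^{(m)}|.$ (iii) $\displaystyle \lim_{p\to\infty}p^m\cdot\mathcal{E}(p,m,f;x)=0.$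
   Context: The Bernoulli polynomials $(B_n)_{n\ge 0}$ are the unique sequence of real polynomials with $B_0(X)=1$ and, for all $n\ge1$, $B_n(X+1)-B_n(X)=nX^{n-1}$ and $\int_0^1B_n(t)\,dt=0$. For $n\ge 0$, $\widetilde{B}_n:\mathbb{R}\to\mathbb{R}$ is the $1$-periodic function $\widetilde{B}_n(x)=B_n(\{x\})$, where $\{x\}=x-\lfloor x\rfloor$ is the fractional part of $x$. *)

(* Defs.v *)
From Stdlib Require Import Reals Factorial Lra Lia.
From Coquelicot Require Import Coquelicot.
Open Scope R_scope.

Definition is_polynomial (P : R -> R) : Prop :=
  exists (n : nat) (a : nat -> R), forall x, P x = sum_n (fun i => a i * x ^ i) n.

(* Real polynomials are identified with the functions they induce on R. *)
Definition is_bernoulli (B : nat -> R -> R) : Prop :=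
  (forall n, is_polynomial (B n)) /\
  (forall x, B 0%nat x = 1) /\
  (forall n, (1 <= n)%nat ->
    (forall x, B n (x + 1) - B n x = INR n * x ^ (n - 1)) /\
    RInt (B n) 0 1 = 0).

Definition periodize (P : R -> R) (x : R) : R := P (frac_part x).

(* A function [0,1] -> C is represented by a function R -> C; only its values
   on [0,1] matter in everything below (derivatives are taken within [0,1],
   hence are one-sided at 0 and 1). *)
Definition I01 (x : R) : Prop := 0 <= x <= 1.

Definition is_derive01 (f : R -> C) (x : R) (l : C) : Prop :=
  filterdiff (U := R_NormedModule) (V := C_R_NormedModule)
    f (within I01 (locally x)) (fun h : R => scal h (l : C_R_NormedModule)).

(* iota returns the unique value satisfying the predicate, when there is one. *)
Definition Derive01 (f : R -> C) (x : R) : C :=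
  iota (T := C_R_CompleteNormedModule) (is_derive01 f x).

Fixpoint Derive01_n (f : R -> C) (k : nat) : R -> C :=
  match k with
  | O => f
  | S k' => Derive01 (Derive01_n f k')
  end.

Definition Cm01 (m : nat) (f : R -> C) : Prop :=
  (forall k x, (k < m)%nat -> I01 x ->
     exists l : C, is_derive01 (Derive01_n f k) x l) /\
  continuous_on I01 (Derive01_n f m).

Definition sup01 (g : R -> R) : R :=
  real (Lub_Rbar (fun r => exists t, I01 t /\ r = g t)).

Definition CRInt (f : R -> C) (a b : R) : C :=
  RInt (V := C_R_CompleteNormedModule) f a b.

Definition ex_CRInt (f : R -> C) (a b : R) : Prop :=
  ex_RInt (V := C_R_NormedModule) f a b.

(* For p = 0 the upper summation bound p - 1 is truncated; only p >= 1 is used. *)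
Definition Hp (p : nat) (f : R -> C) (x : R) : C :=
  (RtoC (/ INR p) *
   sum_n (G := C_AbelianMonoid) (fun k => f ((INR k + x) / INR p)%R) (p - 1))%C.

Definition Eerr (B : nat -> R -> R) (p m : nat) (f : R -> C) (x : R) : C :=
  (CRInt f 0 1 - Hp p f x +
   sum_n_m (G := C_AbelianMonoid)
     (fun k => RtoC (B k x / INR (fact k)) *
               ((Derive01_n f (k - 1) 1 - Derive01_n f (k - 1) 0)
                / RtoC (INR p ^ k)%R)) 1 m)%C.

Lemma polynomial_primitive (P : R -> R) : is_polynomial P ->
  exists T, (forall c d, is_polynomial (fun x => c * T x + d)) /\ T 0 = 0 /\
    forall x, is_derive T x (P x).
Proof.
intros [n [a Ha]].
exists (fun x => sum_n (fun i => a i / INR (S i) * x ^ S i) n); split; [|split].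
- intros c d. exists (S n).
  exists (fun i => match i with O => d | S j => c * (a j / INR (S j)) end).
  intros x. rewrite !sum_n_Reals, (decomp_sum _ (S n)) by lia. simpl Nat.pred.
  rewrite scal_sum.
  rewrite Rplus_comm. f_equal; [simpl; ring|].
  apply sum_eq. intros i _. ring.
- rewrite sum_n_Reals, (sum_eq _ (fun _ => 0)); [rewrite sum_cte; ring|].
  intros i _. rewrite pow_i by lia. ring.
- assert (M : forall (c : R) i x,
    is_derive (fun t => c / INR (S i) * t ^ S i) x (c * x ^ i)).
  { intros c i x. auto_derive; [easy|].
    change (Nat.pred (S i)) with i. field. apply (not_0_INR (S i)); lia. }
  intros x. rewrite Ha. clear Ha. induction n as [|n IH].
  + rewrite sum_O. apply is_derive_ext with (2 := M (a O) O x).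
    intros t. rewrite sum_O. reflexivity.
  + rewrite sum_Sn. apply is_derive_ext with
      (fun t => plus (sum_n (fun i => a i / INR (S i) * t ^ S i) n)
                     (a (S n) / INR (S (S n)) * t ^ S (S n))).
    { intros t. rewrite sum_Sn. reflexivity. }
    apply (is_derive_plus (K := R_AbsRing) (V := R_NormedModule)); [exact IH|apply M].
Qed.

Lemma polynomial_continuous (P : R -> R) : is_polynomial P ->
  forall x, continuous P x.
Proof.
intros [n [a Ha]] x.
apply continuous_ext with (fun x => sum_n (fun i => a i * x ^ i) n);
  [intros; symmetry; apply Ha|].
clear Ha. induction n as [|n IH].
- apply continuous_ext with (fun _ => a O);
    [intros; rewrite sum_O; simpl; ring|apply continuous_const].
- apply continuous_ext with
    (fun x => plus (sum_n (fun i => a i * x ^ i) n) (a (S n) * x ^ S n));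
    [intros; rewrite sum_Sn; reflexivity|].
  apply (continuous_plus (V := R_NormedModule)); [exact IH|].
  apply (ex_derive_continuous (V := R_NormedModule)). auto_derive. easy.
Qed.

Definition bernoulli_next (n : nat) (P : R -> R) (x : R) : R :=
  INR n * RInt P 0 x - RInt (fun t => INR n * RInt P 0 t) 0 1.

Lemma bernoulli_next_spec (n : nat) (P : R -> R) : (1 <= n)%nat ->
  is_polynomial P ->
  (forall x, RInt P x (x + 1) = x ^ (n - 1)) ->
  let Q := bernoulli_next n P in
  is_polynomial Q /\
  (forall x, Q (x + 1) - Q x = INR n * x ^ (n - 1)) /\
  RInt Q 0 1 = 0 /\
  (forall x, RInt Q x (x + 1) = x ^ n).
Proof.
intros Hn HP HI Q.
destruct (polynomial_primitive P HP) as [T [HT [T0 dT]]].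
assert (IP : forall a b, RInt P a b = T b - T a).
{ intros a b. apply is_RInt_unique.
  apply (is_RInt_derive (V := R_CompleteNormedModule) T P).
  - intros t _; apply dT.
  - intros t _; apply polynomial_continuous, HP. }
set (c := INR n).
set (d := RInt (fun t => c * RInt P 0 t) 0 1).
assert (QT : forall x, Q x = c * T x + - d).
{ intros x. unfold Q, bernoulli_next. fold c d. rewrite IP, T0. ring. }
assert (PQ : is_polynomial Q).
{ destruct (HT c (- d)) as [N [a Ha]]. exists N, a. intros x.
  rewrite QT. apply Ha. }
assert (diffQ : forall x, Q (x + 1) - Q x = INR n * x ^ (n - 1)).
{ intros x. rewrite <- (HI x), IP, !QT. unfold c. ring. }
assert (Q01 : RInt Q 0 1 = 0).
{ transitivity (RInt (fun x => plus (c * T x + 0) (- d)) 0 1).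
  { apply RInt_ext. intros t _. rewrite QT. unfold plus; simpl. ring. }
  rewrite (RInt_plus (V := R_CompleteNormedModule)).
  - rewrite RInt_const. unfold d.
    rewrite (RInt_ext (fun t => c * RInt P 0 t) (fun x => c * T x + 0)).
    + change (RInt (fun x => c * T x + 0) 0 1
        + (1 - 0) * - RInt (fun x => c * T x + 0) 0 1 = 0). ring.
    + intros t _. rewrite IP, T0. cbn. ring.
  - apply (ex_RInt_continuous (V := R_CompleteNormedModule)).
    intros t _. apply polynomial_continuous, HT.
  - apply ex_RInt_const. }
split; [exact PQ|split; [exact diffQ|split; [exact Q01|]]].
destruct (polynomial_primitive Q PQ) as [U [_ [_ dU]]].
assert (IQ : forall x, RInt Q x (x + 1) = U (x + 1) - U x).
{ intros x. apply is_RInt_unique.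
  apply (is_RInt_derive (V := R_CompleteNormedModule) U Q).
  - intros t _; apply dU.
  - intros t _; apply polynomial_continuous, PQ. }
(* both sides agree at 0 and have the same derivative *)
intros x. rewrite IQ.
pose (D := fun x => U (x + 1) - U x - x ^ n).
assert (dD : forall t, is_derive D t 0).
{ intros t. unfold D.
  replace 0 with (1 * Q (t + 1) - Q t - INR n * 1 * t ^ (Nat.pred n)).
  - apply (is_derive_minus (V := R_NormedModule)).
    + apply (is_derive_minus (V := R_NormedModule)); [|apply dU].
      apply (is_derive_comp (V := R_NormedModule) U (fun x => x + 1)); [apply dU|].
      auto_derive; [easy|ring].
    + apply (is_derive_pow (fun x => x)). apply (is_derive_id (K := R_AbsRing)).
  - generalize (diffQ t). rewrite <- Nat.sub_1_r. lra. }
assert (HD : D x = D 0).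
{ destruct (MVT_gen D 0 x (fun _ => 0)) as [z [_ Hz]].
  - intros t _; apply dD.
  - intros t _. apply continuity_pt_filterlim.
    apply (ex_derive_continuous (V := R_NormedModule)). exists 0; apply dD.
  - lra. }
unfold D in HD. rewrite (pow_i n) in HD by lia.
rewrite Rplus_0_l in HD.
generalize (IQ 0). rewrite Rplus_0_l, Q01. lra.
Qed.

(* Hypothesis is_bernoulli is satisfiable. *)
Lemma is_bernoulli_exists : exists B, is_bernoulli B.
Proof.
pose (B := fix B (n : nat) : R -> R :=
  match n with O => fun _ => 1 | S k => bernoulli_next (S k) (B k) end).
assert (HB : forall n, is_polynomial (B n) /\ forall x, RInt (B n) x (x + 1) = x ^ n).
{ induction n as [|n [IH1 IH2]].
  - split.
    + exists O, (fun _ => 1). intros x. rewrite sum_O. simpl. ring.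
    + intros x. simpl. rewrite RInt_const. unfold scal; simpl; unfold mult; simpl.
      ring.
  - destruct (bernoulli_next_spec (S n) (B n)) as [H1 [_ [_ H2]]];
      [lia|exact IH1| |split; assumption].
    intros x. rewrite IH2. f_equal. lia. }
exists B. split; [intros n; apply HB|split; [reflexivity|]].
intros [|n] Hn; [lia|]. destruct (HB n) as [H1 H2].
destruct (bernoulli_next_spec (S n) (B n)) as [_ [H3 [H4 _]]];
  [lia|exact H1| |split; assumption].
intros x. rewrite H2. f_equal. lia.
Qed.

Lemma is_derive01_eps (f : R -> C) (x : R) (l : C) :
  is_derive01 f x l ->
  forall eps : posreal, exists d : posreal, forall y, I01 y -> Rabs (y - x) < d ->
    Cmod (f y - f x - RtoC (y - x) * l)%C <= eps * Rabs (y - x).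
Proof.
intros [_ H] eps.
assert (Hlim : is_filter_lim (T := R_UniformSpace) (within I01 (locally x)) x).
{ intros P HP. apply filter_le_within. exact HP. }
destruct (H x Hlim eps) as [d Hd]. exists d. intros y Iy Hy.
specialize (Hd y Hy Iy).
replace (f y - f x - RtoC (y - x) * l)%C with
  (minus (minus (f y) (f x)) (scal (minus y x) l) : C_R_NormedModule).
- rewrite Cmod_norm. exact Hd.
- rewrite scal_R_Cmult. reflexivity.
Qed.

Lemma is_derive01_unique (f : R -> C) (x : R) (l1 l2 : C) :
  I01 x -> is_derive01 f x l1 -> is_derive01 f x l2 -> l1 = l2.
Proof.
intros Hx D1 D2.
destruct (Req_dec (Cmod (l2 - l1)%C) 0) as [H0|H0].
{ apply Cmod_eq_0 in H0. replace l1 with (l2 - (l2 - l1))%C by ring.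
  rewrite H0. ring. }
exfalso.
assert (Hpos : 0 < Cmod (l2 - l1)%C / 4) by (generalize (Cmod_ge_0 (l2 - l1)%C); lra).
destruct (is_derive01_eps f x l1 D1 (mkposreal _ Hpos)) as [d1 H1].
destruct (is_derive01_eps f x l2 D2 (mkposreal _ Hpos)) as [d2 H2].
assert (Hy : exists y, I01 y /\ y <> x /\ Rabs (y - x) < d1 /\ Rabs (y - x) < d2).
{ pose (h := Rmin (/ 2) (Rmin d1 d2 / 2)).
  assert (Hd := Rmin_pos d1 d2 (cond_pos d1) (cond_pos d2)).
  assert (h <= / 2) by apply Rmin_l.
  assert (h <= Rmin d1 d2 / 2) by apply Rmin_r.
  assert (0 < h) by (apply Rmin_pos; lra).
  assert (Rmin d1 d2 <= d1) by apply Rmin_l.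
  assert (Rmin d1 d2 <= d2) by apply Rmin_r.
  unfold I01 in *.
  destruct (Rle_dec x (/ 2)).
  - exists (x + h). replace (x + h - x) with h by ring.
    rewrite Rabs_pos_eq by lra. repeat split; lra.
  - exists (x - h). replace (x - h - x) with (- h) by ring.
    rewrite Rabs_Ropp, Rabs_pos_eq by lra. repeat split; lra. }
destruct Hy as [y [Iy [Nyx [Y1 Y2]]]].
specialize (H1 y Iy Y1). specialize (H2 y Iy Y2). cbn [pos] in H1, H2.
assert (Hk : 0 < Rabs (y - x)) by (apply Rabs_pos_lt; lra).
assert (HT := Cmod_triangle (f y - f x - RtoC (y - x) * l1)%C
                            (- (f y - f x - RtoC (y - x) * l2))%C).
rewrite Cmod_opp in HT.
replace ((f y - f x - RtoC (y - x) * l1) + - (f y - f x - RtoC (y - x) * l2))%C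
  with (RtoC (y - x) * (l2 - l1))%C in HT by ring.
rewrite Cmod_mult, Cmod_R in HT.
assert (0 < Cmod (l2 - l1)%C) by lra.
nra.
Qed.

Lemma Derive01_correct (f : R -> C) (x : R) (l : C) :
  I01 x -> is_derive01 f x l -> Derive01 f x = l.
Proof.
intros Hx Hl.
apply (iota_unique (V := C_R_CompleteNormedModule)); [|exact Hl].
intros y Hy. exact (is_derive01_unique f x y l Hx Hy Hl).
Qed.

(* Main.v *)
(* Write b_n = B_n / n!, so that b_n' = b_(n-1), and b~_n for its periodization.

   (i) On each interval between consecutive points (x + k) / p, the function b~_n (x - p t) is a
   polynomial. Integrating b~_(k+1) (x - p t) f^(k+1) (t) by parts on each of them, the inner
   boundary terms cancel when k >= 1, because b_(k+1) 0 = b_(k+1) 1, and add up to the Riemann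
   sum H_p when k = 0. The formula follows by induction on m.

   (ii) It suffices that the L^1 norm of b_m on [0,1] is at most (8 / pi) / (2 pi)^m, and the L^2 norm
   satisfies this: Wirtinger's inequality gives |b_m|_2 <= |b_(m-1)|_2 / (2 pi) for m >= 2, while
   |b_1|_2 = 1 / sqrt 12, and 2 pi / sqrt 12 <= 8 / pi. For odd m >= 3, b_m vanishes at 0, 1/2 and 1,
   so Wirtinger's inequality is only needed for functions vanishing at both ends of an interval;
   even m follow from the case of m + 1.

   (iii) b~_m (x - p t) has mean zero over each period, of length 1 / p, over which f^(m) varies
   little by uniform continuity. *)

Require Import Defs.
From Stdlib Require Import Reals Factorial Lra Lia.
From Coquelicot Require Import Coquelicot.
Open Scope R_scope.

(** * Bernoulli polynomials *)

(** Integral inequalities below are expressed through primitives, and this takes the place of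
    monotonicity of the integral. *)
Lemma nonneg_derive_le (F dF : R -> R) (a b : R) : a <= b ->
  (forall t, a <= t <= b -> is_derive F t (dF t)) ->
  (forall t, a <= t <= b -> 0 <= dF t) -> F a <= F b.
Proof.
intros Hab HF HdF.
destruct (MVT_gen F a b dF) as [c [Hc E]].
- rewrite Rmin_left, Rmax_right by exact Hab. intros t Ht. apply HF; lra.
- rewrite Rmin_left, Rmax_right by exact Hab. intros t Ht.
  apply continuity_pt_filterlim.
  apply (ex_derive_continuous (V := R_NormedModule)).
  exists (dF t). apply HF; lra.
- rewrite Rmin_left, Rmax_right in Hc by exact Hab.
  assert (0 <= dF c * (b - a)) by (apply Rmult_le_pos; [apply HdF; lra|lra]).
  lra.
Qed.

Lemma const_derive_increment (F : R -> R) (c : R) :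
  (forall t, is_derive F t c) -> forall x y, F y - F x = c * (y - x).
Proof.
intros HF x y.
destruct (MVT_gen F x y (fun _ => c)) as [z [_ E]]; [|intros|exact E].
- intros t _; apply HF.
- apply continuity_pt_filterlim.
  apply (ex_derive_continuous (V := R_NormedModule)). exists c; apply HF.
Qed.

Lemma is_derive_sum_pow (a : nat -> R) (n : nat) (x : R) :
  is_derive (fun t => sum_n (fun i => a i * t ^ i) (S n)) x
    (sum_n (fun i => INR (S i) * a (S i) * x ^ i) n).
Proof.
assert (M : forall i, is_derive (fun t => a (S i) * t ^ S i) x (INR (S i) * a (S i) * x ^ i)).
{ intros i. auto_derive; [easy|]. 
  change (a (S i) * (1 * (INR (S i) * x ^ i)) = INR (S i) * a (S i) * x ^ i). ring. }
induction n as [|n IH].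
- apply is_derive_ext with (fun t => plus (a O) (a 1%nat * t ^ 1)).
  { intros t. rewrite sum_Sn, sum_O. simpl. unfold plus; simpl; ring. }
  rewrite sum_O. evar_last.
  { apply (is_derive_plus (K := R_AbsRing) (V := R_NormedModule));
      [apply is_derive_const|apply M]. }
  apply plus_zero_l.
- rewrite sum_Sn.
  apply is_derive_ext with
    (fun t => plus (sum_n (fun i => a i * t ^ i) (S n)) (a (S (S n)) * t ^ S (S n))).
  { intros t. rewrite (sum_Sn _ (S n)). reflexivity. }
  apply (is_derive_plus (K := R_AbsRing) (V := R_NormedModule)); [exact IH|apply M].
Qed.

(** Induction on the degree bound: the derivative is again 1-periodic, hence constant, so [P] is
    affine, and periodicity forces its slope to be 0. *)
Lemma periodic_polynomial_const (P : R -> R) : is_polynomial P ->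
  (forall x, P (x + 1) = P x) -> forall x, P x = P 0.
Proof.
intros [n [a Ha]]. revert a P Ha.
induction n as [|n IH]; intros a P Ha Hper.
- intros x. rewrite !Ha, !sum_O. simpl. ring.
- set (Q := fun x => sum_n (fun i => INR (S i) * a (S i) * x ^ i) n).
  assert (HQ : forall x, is_derive P x (Q x)).
  { intros x. apply is_derive_ext with (2 := is_derive_sum_pow a n x).
    intros t; symmetry; apply Ha. }
  assert (HQp : forall x, Q (x + 1) = Q x).
  { intros x. rewrite <- (is_derive_unique P x (Q x)) by apply HQ. symmetry.
    apply is_derive_unique.
    apply is_derive_ext with (fun x => P (x + 1)); [exact Hper|].
    evar_last.
    - apply (is_derive_comp P (fun x => x + 1)); [apply HQ|].
      auto_derive; [easy|reflexivity].
    - apply Rmult_1_l. }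
  assert (HQc := IH _ Q (fun x => eq_refl) HQp).
  assert (HP : forall x y, P y - P x = Q 0 * (y - x)).
  { apply const_derive_increment. intros t. rewrite <- (HQc t). apply HQ. }
  intros x. generalize (HP 0 1) (HP 0 x) (Hper 0). rewrite Rplus_0_l.
  intros E1 E2 E3. assert (Q 0 = 0) by lra. rewrite H in E2. lra.
Qed.

Lemma polynomial_minus (P Q : R -> R) : is_polynomial P -> is_polynomial Q ->
  is_polynomial (fun x => P x - Q x).
Proof.
intros [n [a Ha]] [k [c Hc]].
(* Padding with zeros gives both polynomials the common degree bound [n + k]. *)
set (pad := fun (a : nat -> R) n i => if (i <=? n)%nat then a i else 0).
assert (Hpad : forall a n k x,
  sum_n (fun i => pad a n i * x ^ i) (n + k) = sum_n (fun i => a i * x ^ i) n).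
{ intros a' n' k' x. induction k' as [|k' IH].
  - rewrite Nat.add_0_r. apply sum_n_ext_loc. intros i Hi. unfold pad.
    apply Nat.leb_le in Hi. rewrite Hi. reflexivity.
  - rewrite Nat.add_succ_r, sum_Sn, IH. unfold pad.
    replace (S (n' + k') <=? n')%nat with false by (symmetry; apply Nat.leb_gt; lia).
    rewrite Rmult_0_l. apply Rplus_0_r. }
exists (n + k)%nat, (fun i => pad a n i - pad c k i). intros x.
rewrite Ha, Hc, <- (Hpad a n k), <- (Hpad c k n), (Nat.add_comm k n).
rewrite !sum_n_Reals, <- minus_sum. apply sum_eq. intros i _. ring.
Qed.

Lemma continuous_is_derive_RInt (P : R -> R) :
  (forall x, continuous P x) -> forall a x, is_derive (fun t => RInt P a t) x (P x).
Proof.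
intros HP a x. apply (is_derive_RInt (V := R_NormedModule) P _ a); [|apply HP].
apply filter_forall. intros y.
apply (RInt_correct (V := R_CompleteNormedModule)), (ex_RInt_continuous (V := R_CompleteNormedModule)).
intros; apply HP.
Qed.

Section Bernoulli.

Variables (B : nat -> R -> R) (HB : is_bernoulli B).

(** Uniqueness of the sequence. Both sides of the second equation have the same differences over
    steps of length 1, so they differ by a periodic polynomial, hence by a constant, which is 0
    because both have mean zero on [0,1]. The first equation is what [bernoulli_next_spec] requires
    at index [n]; it is carried along by induction. *)
Lemma bernoulli_next_eq (n : nat) (x : R) :
  RInt (B n) x (x + 1) = x ^ n /\ B (S n) x = bernoulli_next (S n) (B n) x.
Proof.
destruct HB as [Hpoly [H0 HS]].
assert (Step : forall n, (forall x, RInt (B n) x (x + 1) = x ^ n) ->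
  (forall x, B (S n) x = bernoulli_next (S n) (B n) x)).
{ clear n x. intros n Hn.
  destruct (bernoulli_next_spec (S n) (B n)) as [H1 [H2 [H3 _]]];
    [lia|apply Hpoly| |].
  { intros x; rewrite Hn; f_equal; lia. }
  set (Q := bernoulli_next (S n) (B n)) in *.
  destruct (HS (S n)) as [H4 H5]; [lia|].
  assert (Hc := periodic_polynomial_const (fun x => B (S n) x - Q x)
    (polynomial_minus _ _ (Hpoly (S n)) H1)).
  cbv beta in Hc.
  assert (Hc' : forall x, B (S n) x - Q x = B (S n) 0 - Q 0).
  { apply Hc. intros t. generalize (H2 t) (H4 t). lra. }
  assert (HI : RInt (fun x => minus (B (S n) x) (Q x)) 0 1 = 0).
  { rewrite (RInt_minus (V := R_CompleteNormedModule)).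
    - rewrite H3, H5. apply Rminus_0_r.
    - apply (ex_RInt_continuous (V := R_CompleteNormedModule)).
      intros; apply polynomial_continuous, Hpoly.
    - apply (ex_RInt_continuous (V := R_CompleteNormedModule)).
      intros; apply polynomial_continuous, H1. }
  rewrite (RInt_ext _ (fun _ => B (S n) 0 - Q 0)), RInt_const in HI
    by (intros t _; apply (Hc' t)).
  unfold scal in HI; simpl in HI; unfold mult in HI; simpl in HI.
  intros x. generalize (Hc' x). lra. }
assert (I : forall n x, RInt (B n) x (x + 1) = x ^ n).
{ clear n x. induction n as [|n IH]; intros x.
  - rewrite (RInt_ext _ (fun _ => 1)), RInt_const by (intros; apply H0).
    unfold scal; simpl; unfold mult; simpl. ring.
  - destruct (bernoulli_next_spec (S n) (B n)) as [_ [_ [_ H2]]];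
      [lia|apply Hpoly| |].
    { intros y; rewrite IH; f_equal; lia. }
    rewrite <- H2. apply RInt_ext. intros t _. apply Step, IH. }
split; [apply I|apply Step, I].
Qed.

Definition bern (n : nat) (x : R) : R := B n x / INR (fact n).

Lemma bern_derive (n : nat) (x : R) : is_derive (bern (S n)) x (bern n x).
Proof.
unfold bern.
apply is_derive_ext with
  (fun t => (INR (S n) * RInt (B n) 0 t
             - RInt (fun t => INR (S n) * RInt (B n) 0 t) 0 1) / INR (fact (S n))).
{ intros t. rewrite (proj2 (bernoulli_next_eq n t)). reflexivity. }
assert (D := continuous_is_derive_RInt (B n)
  (polynomial_continuous _ (proj1 HB n)) 0 x).
rewrite fact_simpl, mult_INR.
assert (NS : INR (S n) <> 0) by (apply not_0_INR; lia).
assert (NF := INR_fact_neq_0 n).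
revert NS NF. generalize (RInt (fun t => INR (S n) * RInt (B n) 0 t) 0 1).
generalize (INR (S n)) (INR (fact n)). intros k F c NS NF.
set (U := fun t => RInt (B n) 0 t) in *.
auto_derive; [exists (B n x); exact D|].
replace (Derive _ x) with (B n x) by (symmetry; exact (is_derive_unique _ _ _ D)).
field. split; assumption.
Qed.

Lemma bern_continuous (n : nat) (x : R) : continuous (bern n) x.
Proof.
apply (continuous_ext (fun t => scal (/ INR (fact n)) (B n t))).
{ intros t. unfold bern, Rdiv. apply Rmult_comm. }
apply (continuous_scal_r (V := R_NormedModule)), polynomial_continuous, HB.
Qed.

Lemma bern_0 (x : R) : bern 0 x = 1.
Proof. unfold bern. rewrite (proj1 (proj2 HB)). simpl. field. Qed.

Lemma bern_1_ends : bern 1 1 - bern 1 0 = 1.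
Proof.
unfold bern. generalize (proj1 (proj2 (proj2 HB) 1%nat (le_n _)) 0).
rewrite Rplus_0_l. simpl. lra.
Qed.

Lemma bern_ends (n : nat) : (2 <= n)%nat -> bern n 1 = bern n 0.
Proof.
intros Hn. unfold bern.
destruct (proj2 (proj2 HB) n) as [H _]; [lia|].
generalize (H 0). rewrite Rplus_0_l, pow_i by lia.
intros E. f_equal. lra.
Qed.

(** By induction the difference [D] of the two sides has derivative 0, so only its constant value
    remains to be found. *)
Lemma bern_reflect (n : nat) (t : R) : bern n (1 - t) = (-1) ^ n * bern n t.
Proof.
revert t. induction n as [|n IH]; intros t.
{ rewrite !bern_0. simpl. ring. }
pose (D := fun t => bern (S n) (1 - t) - (-1) ^ S n * bern (S n) t).
assert (R1 : forall k s, is_derive (fun t => bern (S k) (1 - t)) s (- bern k (1 - s))).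
{ intros k s. evar_last.
  - apply (is_derive_comp (bern (S k)) (fun t => 1 - t)); [apply bern_derive|].
    auto_derive; [easy|reflexivity].
  - unfold scal; simpl; unfold mult; simpl. ring. }
assert (HD : forall s, is_derive D s 0).
{ intros s. unfold D. evar_last.
  - apply (is_derive_minus (V := R_NormedModule)); [apply R1|].
    apply is_derive_scal, bern_derive.
  - rewrite IH. unfold minus, plus, opp; simpl. ring. }
assert (Dc := const_derive_increment D 0 HD).
(* [E] is a primitive of the constant [D]. It takes equal values at 0 and 1 because [bern (S (S n))]
   does, so [D] is 0. *)
pose (E := fun t => - bern (S (S n)) (1 - t) - (-1) ^ S n * bern (S (S n)) t).
assert (HE : forall s, is_derive E s (D 0)).
{ intros s. replace (D 0) with (D s) by (generalize (Dc 0 s); lra). unfold E, D. evar_last.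
  - apply (is_derive_minus (V := R_NormedModule)).
    + apply (is_derive_opp (V := R_NormedModule)), R1.
    + apply is_derive_scal, bern_derive.
  - unfold minus, plus, opp; simpl. ring. }
assert (Ec := const_derive_increment E (D 0) HE 0 1).
unfold E in Ec. rewrite !Rminus_0_r, Rminus_diag, (bern_ends (S (S n))) in Ec by lia.
generalize (Dc 0 t). unfold D at 1. lra.
Qed.

End Bernoulli.

(** * The L2 norm of the Bernoulli polynomials *)

(* With [w = k cot (k (t - a) + d)], which has no pole on [a, c] as long as [k < PI / (c - a)],
   [u'^2 - k^2 u^2 - (u^2 w)' = (u' - u w)^2 >= 0]; then let [k] tend to [PI / (c - a)]. *)
Lemma dirichlet_wirtinger (u du U V : R -> R) (a c : R) : a < c ->
  (forall t, is_derive u t (du t)) ->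
  (forall t, is_derive U t (u t ^ 2)) -> (forall t, is_derive V t (du t ^ 2)) ->
  u a = 0 -> u c = 0 ->
  (PI / (c - a)) ^ 2 * (U c - U a) <= V c - V a.
Proof.
intros Hac Hu HU HV ua uc. assert (Pi0 := PI_RGT_0).
assert (HUp : U a <= U c).
{ apply (nonneg_derive_le U (fun t => u t ^ 2)); [lra|intros; apply HU|].
  intros; apply pow2_ge_0. }
assert (HVp : V a <= V c).
{ apply (nonneg_derive_le V (fun t => du t ^ 2)); [lra|intros; apply HV|].
  intros; apply pow2_ge_0. }
assert (Sub : forall k, 0 < k < PI / (c - a) -> k ^ 2 * (U c - U a) <= V c - V a).
{ intros k [Hk0 Hk].
  assert (HkL : k * (c - a) < PI).
  { apply Rmult_lt_compat_r with (r := c - a) in Hk; [|lra].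
    replace (PI / (c - a) * (c - a)) with PI in Hk by (field; lra). exact Hk. }
  (* This shift centres the phase: it runs from [d] to [PI - d] on [a, c], so its sine stays
     positive. *)
  set (d := (PI - k * (c - a)) / 2).
  pose (W := fun t => V t - k ^ 2 * U t
    - k * (u t ^ 2 * (cos (k * (t - a) + d) / sin (k * (t - a) + d)))).
  enough (HW : W a <= W c).
  { unfold W in HW. rewrite ua, uc in HW. lra. }
  apply (nonneg_derive_le W (fun t => (du t
    - k * (u t * (cos (k * (t - a) + d) / sin (k * (t - a) + d)))) ^ 2));
    [lra| |intros; apply pow2_ge_0].
  intros t Ht.
  assert (Hs : 0 < sin (k * (t - a) + d)).
  { assert (0 <= k * (t - a)) by (apply Rmult_le_pos; lra).
    assert (k * (t - a) <= k * (c - a)) by (apply Rmult_le_compat_l; lra).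
    apply sin_gt_0; unfold d; lra. }
  unfold W. auto_derive.
  - repeat split; try (eexists; first [apply Hu | apply HU | apply HV]).
    exact (Rgt_not_eq _ _ Hs).
  - repeat match goal with |- context [Derive ?F t] =>
      first [rewrite (is_derive_unique F t _ (HU t))
            | rewrite (is_derive_unique F t _ (HV t))
            | rewrite (is_derive_unique F t _ (Hu t))] end.
    unfold Rminus in Hs |- *.
    set (C := cos (k * (t + - a) + d)) in *. set (S := sin (k * (t + - a) + d)) in *.
    field. lra. }
destruct (Rle_lt_dec ((PI / (c - a)) ^ 2 * (U c - U a)) (V c - V a)) as [H|H]; [exact H|].
exfalso.
assert (HP : 0 < PI / (c - a)) by (apply Rdiv_lt_0_compat; lra).
assert (HP2 := pow2_ge_0 (PI / (c - a))).
set (K := PI / (c - a)) in *.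
assert (HA : 0 < U c - U a) by (apply Rnot_le_lt; intro; nra).
(* The midpoint between the quotient and [K ^ 2]: then [sqrt q] is an admissible [k], but [q]
   exceeds the quotient. *)
set (q := ((V c - V a) / (U c - U a) + K ^ 2) / 2).
assert (Hr : (V c - V a) / (U c - U a) < K ^ 2).
{ apply Rmult_lt_reg_r with (U c - U a); [exact HA|].
  unfold Rdiv. rewrite Rmult_assoc, Rinv_l by lra. lra. }
assert (Hr0 : 0 <= (V c - V a) / (U c - U a)).
{ apply Rmult_le_pos; [lra|]. left; apply Rinv_0_lt_compat, HA. }
assert (Hq : 0 < q < K ^ 2) by (unfold q; lra).
specialize (Sub (sqrt q)). rewrite pow2_sqrt in Sub by lra.
assert (q * (U c - U a) <= V c - V a).
{ apply Sub. split; [apply sqrt_lt_R0; lra|].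
  rewrite <- (sqrt_pow2 K) by lra. apply sqrt_lt_1; lra. }
assert (q * (U c - U a) > V c - V a); [|lra].
apply Rlt_gt, Rmult_lt_reg_r with (/ (U c - U a)); [apply Rinv_0_lt_compat, HA|].
rewrite Rmult_assoc, Rinv_r by lra. unfold q, Rdiv in *. lra.
Qed.

Section Energy.

Variables (B : nat -> R -> R) (HB : is_bernoulli B).

Notation bern := (bern B).

(** [energy n 1] is the squared L2 norm on [0,1]. The upper limit is kept variable so that
    [energy n] can serve as a primitive in [dirichlet_wirtinger]. *)
Definition energy (n : nat) (t : R) : R := RInt (fun s => bern n s ^ 2) 0 t.

Lemma bern_sqr_continuous (n : nat) (x : R) : continuous (fun t => bern n t ^ 2) x.
Proof.
apply (continuous_ext (fun t => scal (bern n t) (bern n t))).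
{ intros t. unfold scal; simpl; unfold mult; simpl. ring. }
apply (continuous_scal (V := R_NormedModule)); apply (bern_continuous B HB).
Qed.

Lemma energy_derive (n : nat) (t : R) : is_derive (energy n) t (bern n t ^ 2).
Proof. apply (continuous_is_derive_RInt (fun s => bern n s ^ 2)), bern_sqr_continuous. Qed.

Lemma energy_0 (n : nat) : energy n 0 = 0.
Proof. apply (RInt_point (V := R_CompleteNormedModule)). Qed.

(** Reflection with sign -1 gives zeros at 0, 1/2 and 1. Wirtinger's inequality on each half has the
    constant [(PI / (1/2)) ^ 2], which is four times what [0,1] as a whole would give. *)
Lemma energy_step_odd (n : nat) : Nat.Odd n -> (2 <= n)%nat ->
  (2 * PI) ^ 2 * energy n 1 <= energy (n - 1) 1.
Proof.
intros [k Hk] Hn.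
assert (Hneg : (-1) ^ n = -1).
{ rewrite Hk, Nat.add_1_r. apply pow_1_odd. }
assert (E0 : bern n 0 = 0).
{ generalize (bern_reflect B HB n 0). rewrite Hneg, Rminus_0_r, (bern_ends B HB) by exact Hn. lra. }
assert (E2 : bern n (/ 2) = 0).
{ generalize (bern_reflect B HB n (/ 2)). rewrite Hneg.
  replace (1 - / 2) with (/ 2) by lra. lra. }
assert (E1 : bern n 1 = 0) by (rewrite (bern_ends B HB); assumption).
assert (D : forall t, is_derive (bern n) t (bern (n - 1) t)).
{ intros t. replace n with (S (n - 1)) at 1 by lia. apply (bern_derive B HB). }
assert (H1 := dirichlet_wirtinger (bern n) _ (energy n) (energy (n - 1)) 0 (/ 2)
  ltac:(lra) D (energy_derive n) (energy_derive (n - 1)) E0 E2).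
assert (H2 := dirichlet_wirtinger (bern n) _ (energy n) (energy (n - 1)) (/ 2) 1
  ltac:(lra) D (energy_derive n) (energy_derive (n - 1)) E2 E1).
replace (PI / (/ 2 - 0)) with (2 * PI) in H1 by field.
replace (PI / (1 - / 2)) with (2 * PI) in H2 by field.
rewrite !energy_0 in H1. lra.
Qed.

(* Integrating by parts, [int b_n^2 = - int b_(n-1) b_(n+1)], which reduces the
   even case to the odd one by AM-GM. *)
Lemma energy_step (n : nat) : (2 <= n)%nat ->
  (2 * PI) ^ 2 * energy n 1 <= energy (n - 1) 1.
Proof.
intros Hn. destruct (Nat.Even_or_Odd n) as [He|Ho]; [|apply energy_step_odd; assumption].
assert (Hodd : Nat.Odd (S n)) by (apply Nat.Odd_succ; exact He).
assert (HS := energy_step_odd (S n) Hodd ltac:(lia)).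
replace (S n - 1)%nat with n in HS by lia.
assert (Pi0 := PI_RGT_0). set (K := 2 * PI) in *.
assert (K0 : 0 < K) by (unfold K; lra).
(* The derivative of [2 b_n b_(n+1)] is [2 b_(n-1) b_(n+1) + 2 b_n^2], so [W] has the derivative
   [(b_(n-1) / K + K b_(n+1))^2]. *)
pose (W := fun t => energy (n - 1) t / K ^ 2 + K ^ 2 * energy (S n) t + 2 * energy n t * (-1)
  + 2 * (bern n t * bern (S n) t) * 1).
assert (HW : W 0 <= W 1).
{ apply (nonneg_derive_le W (fun t => (bern (n - 1) t / K + K * bern (S n) t) ^ 2));
    [lra| |intros; apply pow2_ge_0].
  intros t _. unfold W.
  assert (D : is_derive (bern n) t (bern (n - 1) t)).
  { replace n with (S (n - 1)) at 1 by lia. apply (bern_derive B HB). }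
  assert (D' := bern_derive B HB n t).
  assert (D1 := energy_derive (n - 1) t).
  assert (D2 := energy_derive (S n) t).
  assert (D3 := energy_derive n t).
  auto_derive; [repeat split; eexists; eassumption|].
  repeat match goal with |- context [Derive ?F t] =>
    first [rewrite (is_derive_unique F t _ D) | rewrite (is_derive_unique F t _ D')
      | rewrite (is_derive_unique F t _ D1) | rewrite (is_derive_unique F t _ D2)
      | rewrite (is_derive_unique F t _ D3) ] end.
  field. lra. }
(* The product term cancels between 0 and 1. What is left bounds twice [energy n 1] by [energy (n -
   1) 1 / K ^ 2 + K ^ 2 * energy (S n) 1], whose last term is at most [energy n 1] by [HS]. *)
unfold W in HW. rewrite !energy_0, !(bern_ends B HB n), !(bern_ends B HB (S n)) in HW by lia.
assert (K2 : 0 < K ^ 2) by (apply pow_lt, K0).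
assert (H1 : energy n 1 <= energy (n - 1) 1 / K ^ 2) by lra.
apply Rmult_le_compat_l with (r := K ^ 2) in H1; [|lra].
replace (K ^ 2 * (energy (n - 1) 1 / K ^ 2)) with (energy (n - 1) 1) in H1 by (field; lra).
exact H1.
Qed.

Lemma energy_1 : energy 1 1 = 1 / 12.
Proof.
(* The slope is [bern 0 = 1], and reflection gives a zero at 1/2. *)
assert (Hb : forall t, bern 1 t = t - / 2).
{ intros t.
  assert (D := const_derive_increment (bern 1) 1).
  assert (E : bern 1 t - bern 1 (/ 2) = 1 * (t - / 2)).
  { apply D. intros s. rewrite <- (bern_0 B HB s). apply (bern_derive B HB). }
  generalize (bern_reflect B HB 1 (/ 2)). replace (1 - / 2) with (/ 2) by lra.
  lra. }
assert (D : forall t, is_derive (fun t => energy 1 t - (t - / 2) ^ 3 / 3) t 0).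
{ intros t. assert (D1 := energy_derive 1 t). auto_derive.
  - repeat split; eexists; eassumption.
  - match goal with |- context [Derive ?F t] => rewrite (is_derive_unique F t _ D1) end.
    rewrite Hb. field. }
generalize (const_derive_increment _ _ D 0 1). cbv beta. rewrite energy_0. lra.
Qed.

Lemma energy_bound (n : nat) : (1 <= n)%nat ->
  energy n 1 * ((2 * PI) ^ n) ^ 2 <= (2 * PI) ^ 2 / 12.
Proof.
induction n as [|[|n] IH]; intros Hn; [lia| |].
- rewrite energy_1. right. rewrite pow_1. field.
- refine (Rle_trans _ _ _ _ (IH ltac:(lia))).
  assert (H := energy_step (S (S n)) ltac:(lia)).
  replace (S (S n) - 1)%nat with (S n) in H by lia.
  replace (energy (S (S n)) 1 * ((2 * PI) ^ S (S n)) ^ 2)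
    with ((2 * PI) ^ 2 * energy (S (S n)) 1 * ((2 * PI) ^ S n) ^ 2) by (simpl; ring).
  apply Rmult_le_compat_r; [apply pow2_ge_0|exact H].
Qed.

(** This is the inequality [(2 PI)^2 / 12 <= (8 / PI)^2] with denominators cleared. *)
Lemma PI_pow4_le : PI ^ 4 <= 192.
Proof.
(* Five terms of the Leibniz series give about 3.34; any bound whose fourth power is at most 192
   would do. *)
assert (PI <= 3.7).
{ generalize (proj2 (PI_ineq 2)). unfold tg_alt, PI_tg. simpl. lra. }
assert (0 < PI) by apply PI_RGT_0.
apply Rle_trans with (3.7 ^ 4); [apply pow_incr; lra|lra].
Qed.

Lemma energy_le (n : nat) : (1 <= n)%nat ->
  energy n 1 <= (8 / PI * (1 / (2 * PI) ^ n)) ^ 2.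
Proof.
intros Hn. assert (H := energy_bound n Hn).
assert (Pi0 := PI_RGT_0).
assert (P0 : 0 < (2 * PI) ^ n) by (apply pow_lt; lra).
assert (P2 : 0 < ((2 * PI) ^ n) ^ 2) by (apply pow_lt, P0).
assert (Q2 : 0 < PI ^ 2) by (apply pow_lt, Pi0).
assert (Q4 := PI_pow4_le).
apply Rmult_le_reg_r with (1 := P2). apply Rle_trans with (1 := H).
replace ((8 / PI * (1 / (2 * PI) ^ n)) ^ 2 * ((2 * PI) ^ n) ^ 2)
  with (64 / PI ^ 2) by (field; lra).
apply Rmult_le_reg_r with (1 := Q2).
replace (64 / PI ^ 2 * PI ^ 2) with 64 by (field; lra).
lra.
Qed.

End Energy.

(** * Continuously differentiable functions on the unit interval *)

(** Composing with this projection onto [0,1] turns continuity within [0,1] into continuity on all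
    of R, and leaves values on [0,1] unchanged. *)
Definition clamp (t : R) : R := Rmax 0 (Rmin t 1).

Lemma clamp_id (t : R) : I01 t -> clamp t = t.
Proof. unfold I01, clamp. intros [H0 H1]. rewrite Rmin_left, Rmax_right; lra. Qed.

Lemma clamp_I01 (t : R) : I01 (clamp t).
Proof.
unfold I01, clamp. split; [apply Rmax_l|].
apply Rmax_lub; [lra|apply Rmin_r].
Qed.

Lemma clamp_dist (t z : R) : I01 t -> Rabs (clamp z - t) <= Rabs (z - t) /\
  Rabs (z - clamp z) <= Rabs (z - t).
Proof.
unfold I01, clamp, Rmax, Rmin. intros H.
destruct (Rle_dec z 1); destruct (Rle_dec 0 _); unfold Rabs;
  repeat destruct Rcase_abs; lra.
Qed.

Lemma clamp_lipschitz (t z : R) : Rabs (clamp z - clamp t) <= Rabs (z - t).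
Proof.
unfold clamp, Rmax, Rmin.
destruct (Rle_dec z 1); destruct (Rle_dec t 1); repeat destruct (Rle_dec 0 _); unfold Rabs;
  repeat destruct Rcase_abs; lra.
Qed.

Lemma continuous_clamp (g : R -> C) : continuous_on I01 g ->
  forall x, continuous (U := C_R_NormedModule) (fun t => g (clamp t)) x.
Proof.
intros Hg x. unfold continuous.
apply (filterlim_comp _ _ _ clamp g _ (within I01 (locally (clamp x)))).
- intros P [d Hd]. exists d. intros z Hz. apply Hd; [|apply clamp_I01].
  apply Rle_lt_trans with (1 := clamp_lipschitz x z). exact Hz.
- apply Hg, clamp_I01.
Qed.

Lemma is_derive_C_eps (G : R -> C) (x : R) (l : C) :
  (forall eps : posreal, locally x (fun z =>
     Cmod (G z - G x - RtoC (z - x) * l)%C <= eps * Rabs (z - x))) ->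
  is_derive (V := C_R_NormedModule) G x l.
Proof.
intros H. split; [apply (is_linear_scal_l (V := C_R_NormedModule))|].
intros y Hy.
assert (E := is_filter_lim_locally_unique (V := R_NormedModule) x y Hy). subst y.
intros eps. apply (filter_imp _ _) with (2 := H eps). intros z Hz.
replace (G z - G x - RtoC (z - x) * l)%C with
  (minus (minus (G z) (G x)) (scal (minus z x) l) : C_R_NormedModule) in Hz.
- rewrite Cmod_norm in Hz. exact Hz.
- rewrite scal_R_Cmult. reflexivity.
Qed.

(* Beyond the endpoints, continue along the one-sided tangents. *)
Lemma C1_extension (g dg : R -> C) :
  (forall x, I01 x -> is_derive01 g x (dg x)) -> continuous_on I01 dg ->
  exists G : R -> C,
    (forall x, is_derive (V := C_R_NormedModule) G x (dg (clamp x))) /\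
    (forall x, I01 x -> G x = g x).
Proof.
intros Hd Hc.
exists (fun t => (g (clamp t) + RtoC (t - clamp t) * dg (clamp t))%C).
split.
2: { intros x Hx. rewrite clamp_id by exact Hx.
     rewrite Rminus_diag. ring. }
intros x. apply is_derive_C_eps. intros eps.
destruct (Rlt_le_dec x 0) as [Hx0|Hx0];
  [|destruct (Rlt_le_dec 1 x) as [Hx1|Hx1]].
(* Near a point outside [0,1] the extension is affine, so the error is exactly 0. *)
- assert (Neg : forall z, z < 0 -> clamp z = 0).
  { intros z Hz. unfold clamp. rewrite Rmax_left; [reflexivity|].
    apply Rle_trans with z; [apply Rmin_l|lra]. }
  exists (mkposreal (- x) ltac:(lra)). intros z Hz.
  apply Rabs_def2 in Hz. unfold minus, plus, opp in Hz; simpl in Hz.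
  rewrite !Neg by lra.
  match goal with |- Cmod ?e <= _ => replace e with (RtoC 0) end.
  2: { rewrite !RtoC_minus. ring. }
  rewrite Cmod_0. apply Rmult_le_pos; [left; apply cond_pos|apply Rabs_pos].
- assert (Pos : forall z, 1 < z -> clamp z = 1).
  { intros z Hz. unfold clamp. rewrite Rmin_right by lra. apply Rmax_right; lra. }
  exists (mkposreal (x - 1) ltac:(lra)). intros z Hz.
  apply Rabs_def2 in Hz. unfold minus, plus, opp in Hz; simpl in Hz.
  rewrite !Pos by lra.
  match goal with |- Cmod ?e <= _ => replace e with (RtoC 0) end.
  2: { rewrite !RtoC_minus. ring. }
  rewrite Cmod_0. apply Rmult_le_pos; [left; apply cond_pos|apply Rabs_pos].
- assert (Ix : I01 x) by (split; assumption).
  set (e2 := mkposreal (eps / 2) (is_pos_div_2 eps)).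
  destruct (is_derive01_eps g x (dg x) (Hd x Ix) e2) as [d1 Hd1].
  assert (Hc' := proj1 (filterlim_locally_ball_norm (U := C_R_NormedModule) _ _)
    (continuous_clamp dg Hc x) e2).
  destruct Hc' as [d2 Hd2].
  exists (mkposreal (Rmin d1 d2) (Rmin_stable_in_posreal d1 d2)).
  intros z Hz. change (Rabs (z - x) < Rmin d1 d2) in Hz.
  rewrite (clamp_id x Ix) in *.
  destruct (clamp_dist x z Ix) as [C1 C2].
  assert (B1 := Hd1 (clamp z) (clamp_I01 z)
    ltac:(generalize (Rmin_l d1 d2); lra)).
  assert (B2 : Cmod (dg (clamp z) - dg x)%C < eps / 2).
  { rewrite Cmod_norm. apply (Hd2 z).
    apply Rlt_le_trans with (1 := Hz), Rmin_r. }
  (* The error splits into that of [g] at the projected point and the change of slope times the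
     overshoot; each is at most [eps / 2] times the distance from [x] to [z]. *)
  replace (_ - _ - _)%C with
    ((g (clamp z) - g x - RtoC (clamp z - x) * dg x)
     + RtoC (z - clamp z) * (dg (clamp z) - dg x))%C.
  2: { rewrite !RtoC_minus. ring. }
  apply Rle_trans with (1 := Cmod_triangle _ _).
  rewrite Cmod_mult, Cmod_R. simpl in B1.
  assert (Rabs (z - clamp z) * Cmod (dg (clamp z) - dg x)%C <= Rabs (z - x) * (eps / 2)).
  { apply Rmult_le_compat; [apply Rabs_pos|apply Cmod_ge_0|lra|lra]. }
  assert (eps / 2 * Rabs (clamp z - x) <= eps / 2 * Rabs (z - x)).
  { apply Rmult_le_compat_l; [generalize (cond_pos eps); lra|lra]. }
  lra.
Qed.

(** * Integrals against a periodized polynomial *)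

(* [(x + k - 1)/p] and [(x + k)/p] are consecutive discontinuities of the fractional
   part of [x - p t]. *)
Lemma periodize_piece (P : R -> R) (p k : nat) (x t : R) : (1 <= p)%nat ->
  (x + INR k - 1) / INR p < t < (x + INR k) / INR p ->
  periodize P (x - INR p * t) = P (x - INR p * t + INR k).
Proof.
intros Hp [H1 H2].
assert (Hp0 : 0 < INR p) by (apply lt_0_INR; lia).
apply Rmult_lt_compat_l with (1 := Hp0) in H1.
apply Rmult_lt_compat_l with (1 := Hp0) in H2.
replace (INR p * ((x + INR k - 1) / INR p)) with (x + INR k - 1) in H1 by (field; lra).
replace (INR p * ((x + INR k) / INR p)) with (x + INR k) in H2 by (field; lra).
unfold periodize, frac_part.
(* On the open piece, [x - p t] lies strictly between [-k] and [1 - k]. *)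
rewrite <- (Int_part_spec (x - INR p * t) (- Z.of_nat k)).
- f_equal. rewrite opp_IZR, <- INR_IZR_INZ. ring.
- rewrite opp_IZR, <- INR_IZR_INZ. lra.
Qed.

(** The pieces of index 0 to [p] cover [0,1]. The first is cut at 0 and the last at 1, hence the
    hypothesis on subintervals of pieces. *)
Lemma ex_RInt_pieces (F : R -> C) (p : nat) (x : R) : (1 <= p)%nat -> 0 <= x <= 1 ->
  (forall k u v, (x + INR k - 1) / INR p <= u -> u <= v -> v <= (x + INR k) / INR p ->
    ex_RInt (V := C_R_NormedModule) F u v) ->
  ex_RInt (V := C_R_NormedModule) F 0 1.
Proof.
intros Hp Hx HF.
assert (Hp0 : 0 < INR p) by (apply lt_0_INR; lia).
assert (Mono : forall a c, a <= c -> a / INR p <= c / INR p).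
{ intros a c Hac. apply Rmult_le_compat_r; [left; apply Rinv_0_lt_compat|]; assumption. }
assert (H : forall n, ex_RInt (V := C_R_NormedModule) F 0 ((x + INR n) / INR p)).
{ induction n as [|n IH].
  - apply (HF O); simpl.
    + replace 0 with (0 / INR p) by (field; lra). apply Mono; lra.
    + replace 0 with (0 / INR p) by (field; lra). apply Mono; lra.
    + apply Mono; lra.
  - apply (ex_RInt_Chasles F) with (1 := IH).
    apply (HF (S n)); rewrite S_INR; apply Mono; lra. }
apply (ex_RInt_Chasles F) with (1 := H (p - 1)%nat).
rewrite minus_INR by exact Hp. simpl (INR 1).
replace 1 with (INR p / INR p) at 2 by (field; lra).
apply (HF p); apply Mono; lra.
Qed.

Lemma ex_RInt_periodize_piece (P : R -> R) (h : R -> C) (p k : nat) (x u v : R) :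
  (1 <= p)%nat ->
  (forall t, continuous P t) -> (forall t, continuous (U := C_R_NormedModule) h t) ->
  (x + INR k - 1) / INR p <= u -> u <= v -> v <= (x + INR k) / INR p ->
  ex_CRInt (fun t => (RtoC (periodize P (x - INR p * t)) * h t)%C) u v.
Proof.
intros Hp HP Hh Hu Huv Hv.
apply (ex_RInt_ext (V := C_R_NormedModule)) with
  (fun t => scal (P (x - INR p * t + INR k)) (h t : C_R_NormedModule)).
- rewrite Rmin_left, Rmax_right by exact Huv. intros t Ht.
  rewrite (periodize_piece P p k) by (exact Hp || lra). apply scal_R_Cmult.
- apply (ex_RInt_continuous (V := C_R_CompleteNormedModule)). intros t _.
  apply (continuous_scal (V := C_R_NormedModule)); [|apply Hh].
  apply (continuous_comp (fun t => x - INR p * t + INR k) P); [|apply HP].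
  apply (ex_derive_continuous (V := R_NormedModule)). auto_derive. easy.
Qed.

Lemma ex_RInt_periodize (P : R -> R) (h : R -> C) (p : nat) (x : R) :
  (1 <= p)%nat -> 0 <= x <= 1 ->
  (forall t, continuous P t) -> (forall t, continuous (U := C_R_NormedModule) h t) ->
  ex_CRInt (fun t => (RtoC (periodize P (x - INR p * t)) * h t)%C) 0 1.
Proof.
intros Hp Hx HP Hh. apply (ex_RInt_pieces _ p x Hp Hx). intros k u v.
apply ex_RInt_periodize_piece; assumption.
Qed.

(** Inside one piece the integrand is the derivative of [P (x - p t + k) * G t]; the values of the
    periodization at the two ends do not affect the integral. *)
Lemma is_RInt_parts_piece (P Q : R -> R) (G dG : R -> C) (p k : nat) (x u v : R) :
  (1 <= p)%nat ->
  (forall t, is_derive P t (Q t)) -> (forall t, continuous Q t) ->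
  (forall t, is_derive (V := C_R_NormedModule) G t (dG t)) ->
  (forall t, continuous (U := C_R_NormedModule) dG t) ->
  (x + INR k - 1) / INR p <= u -> u <= v -> v <= (x + INR k) / INR p ->
  is_RInt (V := C_R_NormedModule)
    (fun t => RtoC (periodize P (x - INR p * t)) * dG t
              - RtoC (INR p * periodize Q (x - INR p * t))%R * G t)%C u v
    (RtoC (P (x - INR p * v + INR k)%R) * G v
     - RtoC (P (x - INR p * u + INR k)%R) * G u)%C.
Proof.
intros Hp HP HQ HG HdG Hu Huv Hv.
assert (Hc : forall t, continuous (fun t => x - INR p * t + INR k) t).
{ intros t. apply (ex_derive_continuous (V := R_NormedModule)). auto_derive. easy. }
assert (D := is_RInt_scal_derive (V := C_R_CompleteNormedModule)
  (fun t => P (x - INR p * t + INR k)) G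
  (fun t => - INR p * Q (x - INR p * t + INR k)) dG u v).
evar_last.
- refine (is_RInt_ext (V := C_R_NormedModule) _ _ u v _ _ (D _ _ _ _)).
  + rewrite Rmin_left, Rmax_right by exact Huv. intros t Ht.
    rewrite (periodize_piece P p k), (periodize_piece Q p k) by (exact Hp || lra).
    rewrite !scal_R_Cmult.
    change (RtoC (- INR p * Q (x - INR p * t + INR k))%R * G t
      + RtoC (P (x - INR p * t + INR k)%R) * dG t
      = RtoC (P (x - INR p * t + INR k)%R) * dG t
        - RtoC (INR p * Q (x - INR p * t + INR k))%R * G t)%C.
    rewrite !RtoC_mult, RtoC_opp. ring.
  + intros t _. evar_last.
    * apply (is_derive_comp P (fun t => x - INR p * t + INR k)); [apply HP|].
      auto_derive; [easy|reflexivity].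
    * unfold scal; simpl; unfold mult; simpl. ring.
  + intros t _. apply HG.
  + intros t _. apply (continuous_scal_r (V := R_NormedModule)).
    apply (continuous_comp (fun t => x - INR p * t + INR k) Q); [apply Hc|apply HQ].
  + intros t _. apply HdG.
- rewrite !scal_R_Cmult. reflexivity.
Qed.

(** At each node [(x + k) / p] with [k < p], the piece on the left contributes [P 0] and the one on
    the right [- P 1]; these jumps add up to a multiple of [Hp p G x]. The ends 0 and 1 contribute
    the remaining term. *)
Lemma is_RInt_parts (P Q : R -> R) (G dG : R -> C) (p : nat) (x : R) :
  (1 <= p)%nat -> 0 <= x <= 1 ->
  (forall t, is_derive P t (Q t)) -> (forall t, continuous Q t) ->
  (forall t, is_derive (V := C_R_NormedModule) G t (dG t)) ->
  (forall t, continuous (U := C_R_NormedModule) dG t) ->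
  is_RInt (V := C_R_NormedModule)
    (fun t => RtoC (periodize P (x - INR p * t)) * dG t
              - RtoC (INR p * periodize Q (x - INR p * t))%R * G t)%C 0 1
    (RtoC (P x) * (G 1 - G 0)
     + RtoC (INR p) * RtoC (P 0 - P 1) * Hp p G x)%C.
Proof.
intros Hp Hx HP HQ HG HdG.
assert (Hp0 : 0 < INR p) by (apply lt_0_INR; lia).
assert (Mono : forall a c, a <= c -> a / INR p <= c / INR p).
{ intros a c Hac. apply Rmult_le_compat_r; [left; apply Rinv_0_lt_compat|]; assumption. }
assert (Z : 0 / INR p = 0) by (field; lra).
assert (Pc := fun k u v => is_RInt_parts_piece P Q G dG p k x u v Hp HP HQ HG HdG).
set (F := fun t => _) in Pc |- *.
set (Sg := sum_n (G := C_AbelianMonoid) (fun k => G ((INR k + x) / INR p)%R)).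
(* The last node has only received [P 0] so far; this is written as [P 1] plus the jump, so that
   [Sg n] includes it and the next piece removes the [P 1]. *)
assert (H : forall n, is_RInt (V := C_R_NormedModule) F 0 ((x + INR n) / INR p)
  (RtoC (P 1) * G ((x + INR n) / INR p)%R - RtoC (P x) * G 0
    + RtoC (P 0 - P 1) * Sg n)%C).
{ induction n as [|n IH].
  - evar_last.
    + apply (Pc O); simpl.
      * rewrite <- Z at 2. apply Mono; lra.
      * rewrite <- Z at 1. apply Mono; lra.
      * apply Mono; lra.
    + unfold Sg. rewrite sum_O. simpl (INR 0).
      replace (x - INR p * 0 + 0) with x by ring.
      replace (x - INR p * ((x + 0) / INR p) + 0) with 0 by (field; lra).
      rewrite (Rplus_comm 0 x), RtoC_minus. ring.
  - evar_last.
    + apply (is_RInt_Chasles (V := C_R_NormedModule)) with (1 := IH).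
      apply (Pc (S n)); rewrite S_INR; apply Mono; lra.
    + unfold Sg. rewrite (sum_Sn _ n). fold Sg.
      rewrite (Rplus_comm (INR (S n)) x).
      replace (x - INR p * ((x + INR (S n)) / INR p) + INR (S n)) with 0 by (field; lra).
      replace (x - INR p * ((x + INR n) / INR p) + INR (S n)) with 1
        by (rewrite S_INR; field; lra).
      change (@plus (NormedModule.AbelianMonoid R_AbsRing C_R_NormedModule)) with Cplus.
      change (@plus C_AbelianMonoid) with Cplus.
      rewrite RtoC_minus. ring. }
evar_last.
- apply (is_RInt_Chasles (V := C_R_NormedModule)) with (1 := H (p - 1)%nat).
  rewrite minus_INR by exact Hp. simpl (INR 1).
  apply (Pc p).
  + apply Mono; lra.
  + replace 1 with (INR p / INR p) at 2 by (field; lra). apply Mono; lra.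
  + replace 1 with (INR p / INR p) at 1 by (field; lra). apply Mono; lra.
- unfold Defs.Hp. fold Sg. rewrite minus_INR by exact Hp. simpl (INR 1).
  replace (x - INR p * 1 + INR p) with x by ring.
  replace (x - INR p * ((x + (INR p - 1)) / INR p) + INR p) with 1 by (field; lra).
  change (@plus (NormedModule.AbelianMonoid R_AbsRing C_R_NormedModule)) with Cplus.
  rewrite RtoC_inv, RtoC_minus by lra. field.
  intro E. apply RtoC_inj in E. lra.
Qed.

Lemma Hp_1 (p : nat) (x : R) : (1 <= p)%nat -> Hp p (fun _ => RtoC 1) x = RtoC 1.
Proof.
intros Hp0. unfold Hp.
assert (H : forall n, sum_n (G := C_AbelianMonoid) (fun _ => RtoC 1) n = RtoC (INR (S n))).
{ induction n as [|n IH].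
  - apply sum_O.
  - rewrite sum_Sn, IH, (S_INR (S n)). symmetry. apply RtoC_plus. }
rewrite H, <- RtoC_mult. f_equal. replace (S (p - 1)) with p by lia.
field. apply not_0_INR; lia.
Qed.

Lemma is_RInt_Re (g : R -> C) (a c : R) (l : C) :
  is_RInt (V := C_R_NormedModule) g a c l ->
  is_RInt (V := R_NormedModule) (fun t => Re (g t)) a c (Re l).
Proof. exact (is_RInt_fct_extend_fst (U := R_NormedModule) (V := R_NormedModule) g a c l). Qed.

(** Integration by parts against the constant 1, where only the jumps remain; the result is divided
    by [- p]. *)
Lemma is_RInt_periodize (P Q : R -> R) (p : nat) (x : R) :
  (1 <= p)%nat -> 0 <= x <= 1 ->
  (forall t, is_derive P t (Q t)) -> (forall t, continuous Q t) ->
  is_RInt (fun t => periodize Q (x - INR p * t)) 0 1 (P 1 - P 0).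
Proof.
intros Hp0 Hx HP HQ.
assert (Hp1 : 0 < INR p) by (apply lt_0_INR; lia).
assert (D := is_RInt_parts P Q (fun _ => RtoC 1) (fun _ => RtoC 0) p x Hp0 Hx HP HQ
  (fun t => is_derive_const (V := C_R_NormedModule) (RtoC 1) t)
  (fun t => continuous_const (V := C_R_NormedModule) (RtoC 0) t)).
apply is_RInt_Re in D.
apply (is_RInt_scal (V := R_NormedModule) _ _ _ (- / INR p)) in D.
evar_last.
- refine (is_RInt_ext (V := R_NormedModule) _ _ 0 1 _ _ D). intros t _.
  unfold scal; simpl; unfold mult; simpl. field. lra.
- rewrite Hp_1 by exact Hp0. unfold scal; simpl; unfold mult; simpl. field. lra.
Qed.

Lemma periodize_bound (P : R -> R) (M : R) :
  (forall t, 0 <= t <= 1 -> Rabs (P t) <= M) -> forall y, Rabs (periodize P y) <= M.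
Proof.
intros H y. apply H. destruct (base_fp y). lra.
Qed.

(* Pointwise, [|P| <= (P^2 / s + s) / 2]: this replaces the Cauchy-Schwarz inequality. *)
Lemma Cmod_RInt_periodize_le (P : R -> R) (E : R -> R) (h : R -> C) (p : nat) (x s S : R)
  (l : C) :
  (1 <= p)%nat -> 0 <= x <= 1 -> 0 < s ->
  (forall t, continuous P t) -> (forall t, is_derive E t (P t ^ 2)) ->
  E 1 - E 0 <= s ^ 2 -> (forall t, 0 <= t <= 1 -> Cmod (h t) <= S) ->
  is_RInt (V := C_R_NormedModule)
    (fun t => RtoC (periodize P (x - INR p * t)) * h t)%C 0 1 l ->
  Cmod l <= S * s.
Proof.
intros Hp0 Hx Hs HPc HE Hle Hh Hl.
assert (S0 : 0 <= S).
{ apply Rle_trans with (2 := Hh 0 ltac:(lra)). apply Cmod_ge_0. }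
assert (HQ : forall t, continuous (fun t => P t ^ 2) t).
{ intros t. apply (continuous_ext (fun t => scal (P t) (P t))).
  - intros y. unfold scal; simpl; unfold mult; simpl. ring.
  - apply (continuous_scal (V := R_NormedModule)); apply HPc. }
assert (D := is_RInt_periodize E (fun t => P t ^ 2) p x Hp0 Hx HE HQ).
(* The majorant is [S / (2 s) * (P^2 + s^2)] with [P] periodized; its integral is at most [S s]
   since that of [P^2] is at most [s^2]. *)
assert (D2 := is_RInt_scal (V := R_NormedModule) _ _ _ (S / (2 * s)) _
  (is_RInt_plus (V := R_NormedModule) _ _ _ _ _ _ D
     (is_RInt_const (V := R_NormedModule) 0 1 (s ^ 2)))).
apply Rle_trans with (S / (2 * s) * (E 1 - E 0 + s ^ 2)).
- rewrite Cmod_norm.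
  refine (norm_RInt_le _ _ 0 1 l _ ltac:(lra) _ Hl _).
  2: { evar_last; [exact D2|]. unfold scal, plus; simpl; unfold mult; simpl. ring. }
  intros t Ht. rewrite <- Cmod_norm, Cmod_mult, Cmod_R.
  unfold scal, plus; simpl; unfold mult; simpl.
  unfold periodize. set (y := P _).
  assert (H := Hh t Ht). assert (Hy := pow2_ge_0 (Rabs y - s)).
  assert (Hy2 : Rabs y * Rabs y = y * y) by (rewrite <- Rabs_mult; apply Rabs_pos_eq, Rle_0_sqr).
  apply Rle_trans with (Rabs y * S).
  + apply Rmult_le_compat_l; [apply Rabs_pos|exact H].
  + rewrite !Rmult_1_r, <- Hy2.
    replace (Rabs y * S) with (S / (2 * s) * (2 * s * Rabs y)) by (field; lra).
    apply Rmult_le_compat_l.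
    * apply Rmult_le_pos; [exact S0|]. left; apply Rinv_0_lt_compat; lra.
    * simpl in Hy. lra.
- replace (S * s) with (S / (2 * s) * (s ^ 2 + s ^ 2)) by (field; lra).
  apply Rmult_le_compat_l; [|lra].
  apply Rmult_le_pos; [exact S0|]. left; apply Rinv_0_lt_compat; lra.
Qed.

(* The mean of [Q] over a period vanishes, so [h] may be replaced by [h t - h u]. *)
Lemma Cmod_RInt_full_piece_le (P Q : R -> R) (h : R -> C) (p k : nat) (x M e : R) (l : C) :
  (1 <= p)%nat ->
  (forall t, is_derive P t (Q t)) -> (forall t, continuous Q t) -> P 1 = P 0 ->
  (forall t, 0 <= t <= 1 -> Rabs (Q t) <= M) ->
  let u := (x + INR k - 1) / INR p in let v := (x + INR k) / INR p in
  (forall t, u <= t <= v -> Cmod (h t - h u)%C <= e) ->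
  is_RInt (V := C_R_NormedModule)
    (fun t => RtoC (periodize Q (x - INR p * t)) * h t)%C u v l ->
  Cmod l <= / INR p * (M * e).
Proof.
intros Hp0 HP HQ HP01 HM u v He Hl.
assert (Hp1 : 0 < INR p) by (apply lt_0_INR; lia).
assert (Euv : v - u = / INR p) by (unfold u, v; field; lra).
assert (Hi : 0 < / INR p) by (apply Rinv_0_lt_compat, Hp1).
(* With the constant [h u] as [G], the boundary terms cancel because [P 1 = P 0]. Adding [/ p] times
   this null integral subtracts [h u] from [h t]. *)
assert (D := is_RInt_parts_piece P Q (fun _ => h u) (fun _ => RtoC 0) p k x u v Hp0 HP HQ
  (fun t => is_derive_const (V := C_R_NormedModule) (h u) t)
  (fun t => continuous_const (V := C_R_NormedModule) (RtoC 0) t)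
  (Rle_refl _) ltac:(lra) (Rle_refl _)).
assert (D2 := is_RInt_plus (V := C_R_NormedModule) _ _ _ _ _ _ Hl
  (is_RInt_scal (V := C_R_NormedModule) _ _ _ (/ INR p) _ D)).
rewrite <- Euv, Cmod_norm.
apply (norm_RInt_le_const (V := C_R_NormedModule)
  (fun t => RtoC (periodize Q (x - INR p * t)) * (h t - h u))%C); [lra| |].
- intros t Ht. rewrite <- Cmod_norm, Cmod_mult, Cmod_R.
  apply Rmult_le_compat; [apply Rabs_pos|apply Cmod_ge_0| |apply He, Ht].
  apply periodize_bound, HM.
- evar_last.
  + refine (is_RInt_ext (V := C_R_NormedModule) _ _ u v _ _ D2). intros t _.
    rewrite scal_R_Cmult.
    change (@plus (NormedModule.AbelianMonoid R_AbsRing C_R_NormedModule)) with Cplus.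
    rewrite RtoC_mult, RtoC_inv by lra.
    match goal with |- @eq _ ?y ?z => change (@eq C y z) end. field.
    intro E. apply RtoC_inj in E. lra.
  + rewrite scal_R_Cmult.
    change (@plus (NormedModule.AbelianMonoid R_AbsRing C_R_NormedModule)) with Cplus.
    replace (x - INR p * v + INR k) with 0 by (unfold v; field; lra).
    replace (x - INR p * u + INR k) with 1 by (unfold u; field; lra).
    rewrite HP01. ring.
Qed.

(** A Riemann-Lebesgue lemma. The [p - 1] full periods contribute at most [M e / p] each, where [e]
    bounds the oscillation of [h] over a period; the two cut pieces contribute at most [K M / p]
    each. *)
Lemma filterlim_RInt_periodize (P Q : R -> R) (h : R -> C) (x : R) : 0 <= x <= 1 ->
  (forall t, is_derive P t (Q t)) -> (forall t, continuous Q t) -> P 1 = P 0 ->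
  (forall t, continuous (U := C_R_NormedModule) h t) ->
  filterlim (fun p : nat => CRInt (fun t => RtoC (periodize Q (x - INR p * t)) * h t)%C 0 1)
    eventually (locally (RtoC 0)).
Proof.
intros Hx HP HQ HP01 Hh.
destruct (bounded_continuity (V := R_NormedModule) Q 0 1 (fun t _ => HQ t)) as [M HM].
destruct (bounded_continuity (V := C_R_NormedModule) h 0 1 (fun t _ => Hh t)) as [K HK].
assert (HM' : forall t, 0 <= t <= 1 -> Rabs (Q t) <= M) by (intros t Ht; left; apply HM, Ht).
assert (HK' : forall t, 0 <= t <= 1 -> Cmod (h t) <= K).
{ intros t Ht; rewrite Cmod_norm; left; apply HK, Ht. }
assert (M0 : 0 <= M) by (apply Rle_trans with (2 := HM' 0 ltac:(lra)); apply Rabs_pos).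
assert (K0 : 0 <= K) by (apply Rle_trans with (2 := HK' 0 ltac:(lra)); apply Cmod_ge_0).
apply (proj2 (filterlim_locally_ball_norm (U := C_R_NormedModule) _ _)).
intros eps.
assert (He : 0 < eps / (2 * (M + 1))).
{ apply Rdiv_lt_0_compat; [apply cond_pos|lra]. }
(* Chosen so that [M e <= eps / 2]; the 1 keeps the denominator positive when [M] is 0. *)
set (e := eps / (2 * (M + 1))) in *.
destruct (unifcont_normed_1d (V := C_R_NormedModule) h 0 1 (fun t _ => Hh t) (mkposreal e He))
  as [d Hd].
(* Beyond [N], a period is shorter than [d] and the cut pieces together stay below [eps / 2]. *)
destruct (nfloor_ex (/ d + 4 * (K * M) / eps)) as [N [_ HN]].
{ apply Rplus_le_le_0_compat; [left; apply Rinv_0_lt_compat, cond_pos|].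
  apply Rmult_le_pos; [|left; apply Rinv_0_lt_compat, cond_pos].
  assert (0 <= K * M) by (apply Rmult_le_pos; assumption). lra. }
exists (S N). intros p Hp.
assert (HpN : INR N + 1 <= INR p) by (rewrite <- S_INR; apply le_INR, Hp).
assert (KM0 : 0 <= K * M) by (apply Rmult_le_pos; assumption).
assert (dpos := cond_pos d). assert (epos := cond_pos eps).
assert (Id : 0 < / d) by (apply Rinv_0_lt_compat; assumption).
assert (Q0 : 0 <= 4 * (K * M) / eps).
{ apply Rmult_le_pos; [lra|left; apply Rinv_0_lt_compat; assumption]. }
assert (Hp0 : 0 < INR p) by lra.
assert (Hp1 : (1 <= p)%nat) by lia.
assert (Hpd : / INR p < d).
{ rewrite <- (Rinv_inv d). apply Rinv_lt_contravar; [apply Rmult_lt_0_compat; lra|lra]. }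
assert (HpK : 2 * (K * M) * / INR p < eps / 2).
{ apply Rmult_lt_reg_r with (INR p); [exact Hp0|].
  rewrite Rmult_assoc, Rinv_l, Rmult_1_r by lra.
  assert (H : 4 * (K * M) / eps < INR p) by lra.
  apply Rmult_lt_compat_l with (1 := epos) in H.
  replace (eps * (4 * (K * M) / eps)) with (4 * (K * M)) in H by (field; lra). lra. }
assert (Ip : 0 < / INR p) by (apply Rinv_0_lt_compat; assumption).
assert (Mono : forall a c, a <= c -> a / INR p <= c / INR p).
{ intros a c Hac. apply Rmult_le_compat_r; [left|]; assumption. }
assert (Z : 0 / INR p = 0) by (field; lra).
assert (U : INR p / INR p = 1) by (field; lra).
set (F := fun t => _).
assert (FB : forall t, 0 <= t <= 1 -> Cmod (F t) <= K * M).
{ intros t Ht. unfold F. rewrite Cmod_mult, Cmod_R, Rmult_comm.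
  apply Rmult_le_compat; [apply Cmod_ge_0|apply Rabs_pos|apply HK', Ht|].
  apply periodize_bound, HM'. }
assert (EF : forall k u v, (x + INR k - 1) / INR p <= u -> u <= v -> v <= (x + INR k) / INR p ->
  exists l, is_RInt (V := C_R_NormedModule) F u v l).
{ intros k u v. apply ex_RInt_periodize_piece; assumption. }
(* For the cut pieces, where the mean of [Q] need not vanish, the length alone suffices. *)
assert (Short : forall u v l, 0 <= u -> u <= v -> v <= 1 -> v - u <= / INR p ->
  is_RInt (V := C_R_NormedModule) F u v l -> Cmod l <= K * M * / INR p).
{ intros u v l Hu Huv Hv Hs Hl. rewrite Cmod_norm.
  apply Rle_trans with ((v - u) * (K * M)).
  - apply (norm_RInt_le_const (V := C_R_NormedModule) F); [exact Huv| |exact Hl].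
    intros t Ht. rewrite <- Cmod_norm. apply FB. lra.
  - rewrite Rmult_comm. apply Rmult_le_compat_l; assumption. }
assert (H : forall n, (n < p)%nat -> exists l,
  is_RInt (V := C_R_NormedModule) F 0 ((x + INR n) / INR p) l /\
  Cmod l <= K * M * / INR p + INR n * (/ INR p * (M * e))).
{ induction n as [|n IH]; intros Hn.
  - destruct (EF O 0 ((x + INR 0) / INR p)) as [l Hl].
    + rewrite <- Z. simpl. apply Mono; lra.
    + rewrite <- Z at 1. simpl. apply Mono; lra.
    + apply Rle_refl.
    + exists l. split; [exact Hl|].
      simpl (INR 0) in *. rewrite Rmult_0_l, Rplus_0_r in *.
      apply (Short 0 (x / INR p)); [lra| | | |exact Hl].
      * rewrite <- Z. apply Mono; lra.
      * rewrite <- U. apply Mono. assert (1 <= INR p) by (apply (le_INR 1); lia). lra.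
      * unfold Rdiv. rewrite Rminus_0_r.
        rewrite <- (Rmult_1_l (/ INR p)) at 2. apply Rmult_le_compat_r; lra.
  - destruct IH as [l1 [Hl1 Bl1]]; [lia|].
    assert (Hn' : INR (S n) + 1 <= INR p) by (rewrite <- S_INR; apply le_INR; lia).
    assert (Hn0 := pos_INR n). rewrite S_INR in Hn'.
    replace ((x + INR n) / INR p) with ((x + INR (S n) - 1) / INR p) in Hl1
      by (rewrite S_INR; field; lra).
    destruct (EF (S n) ((x + INR (S n) - 1) / INR p) ((x + INR (S n)) / INR p))
      as [l2 Hl2]; [apply Rle_refl|apply Mono; lra|apply Rle_refl|].
    exists (plus (l1 : C_R_NormedModule) l2). split.
    + apply (is_RInt_Chasles (V := C_R_NormedModule)) with (1 := Hl1) (2 := Hl2).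
    + assert (B2 : Cmod l2 <= / INR p * (M * e)).
      { apply (Cmod_RInt_full_piece_le P Q h p (S n) x M e l2 Hp1 HP HQ HP01 HM'); [|exact Hl2].
        assert (L : 0 <= (x + INR (S n) - 1) / INR p)
          by (rewrite <- Z, S_INR; apply Mono; lra).
        assert (L2 : (x + INR (S n)) / INR p <= 1)
          by (rewrite <- U, S_INR; apply Mono; lra).
        assert (W : (x + INR (S n)) / INR p - (x + INR (S n) - 1) / INR p = / INR p)
          by (field; lra).
        intros t Ht. rewrite Cmod_norm. left.
        apply (Hd ((x + INR (S n) - 1) / INR p) t); [lra|lra|].
        change (Rabs (t - (x + INR (S n) - 1) / INR p) < d).
        rewrite Rabs_pos_eq; lra. }
      rewrite S_INR.
      apply Rle_trans with (1 := Cmod_triangle l1 l2). lra. }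
destruct (H (p - 1)%nat) as [l1 [Hl1 B1]]; [lia|].
rewrite minus_INR in Hl1, B1 by exact Hp1. simpl (INR 1) in Hl1, B1.
destruct (EF p ((x + (INR p - 1)) / INR p) 1) as [l2 Hl2].
{ apply Mono; lra. }
{ rewrite <- U. apply Mono; lra. }
{ rewrite <- U. apply Mono; lra. }
assert (B2 : Cmod l2 <= K * M * / INR p).
{ assert (1 <= INR p) by (apply (le_INR 1); lia).
  assert (W : 1 - (x + (INR p - 1)) / INR p = (1 - x) * / INR p) by (field; lra).
  apply (Short ((x + (INR p - 1)) / INR p) 1); [| | | |exact Hl2].
  - rewrite <- Z. apply Mono; lra.
  - rewrite <- U. apply Mono; lra.
  - lra.
  - rewrite W. rewrite <- (Rmult_1_l (/ INR p)) at 2. apply Rmult_le_compat_r; lra. }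
unfold CRInt.
rewrite (is_RInt_unique (V := C_R_CompleteNormedModule) F 0 1 _
  (is_RInt_Chasles (V := C_R_NormedModule) _ _ _ _ _ _ Hl1 Hl2)).
change (norm (minus (l1 + l2)%C (RtoC 0) : C_R_NormedModule) < eps).
rewrite <- Cmod_norm.
replace (minus (l1 + l2)%C (RtoC 0) : C) with (l1 + l2)%C.
2: { change (l1 + l2 = l1 + l2 - 0)%C. ring. }
apply Rle_lt_trans with (1 := Cmod_triangle l1 l2).
assert (Me : M * e <= eps / 2).
{ unfold e. replace (eps / 2) with ((M + 1) * (eps / (2 * (M + 1)))) by (field; lra).
  apply Rmult_le_compat_r; [left; exact He|lra]. }
assert ((INR p - 1) * (/ INR p * (M * e)) <= M * e).
{ replace (M * e) with (INR p * (/ INR p * (M * e))) at 2 by (field; lra).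
  apply Rmult_le_compat_r; [|lra].
  apply Rmult_le_pos; [lra|]. apply Rmult_le_pos; [exact M0|left; exact He]. }
lra.
Qed.

(** * The Euler-Maclaurin formula and the three claims *)

Lemma sup01_ub (g : R -> R) (M : R) :
  (forall t, I01 t -> g t <= M) -> forall t, I01 t -> g t <= sup01 g.
Proof.
intros HM t Ht. unfold sup01.
destruct (Lub_Rbar_correct (fun r => exists t, I01 t /\ r = g t)) as [Hub Hlub].
assert (H1 := Hub (g t) (ex_intro _ t (conj Ht eq_refl))).
(* The bound [M] excludes an infinite supremum, which [real] would turn into 0. *)
assert (H2 := Hlub (Finite M)). 
destruct (Lub_Rbar _) as [r| |].
- exact H1.
- exfalso. apply H2. intros r [s [Hs ->]]. apply HM, Hs.
- contradiction.
Qed.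

Section EulerMaclaurin.

Variables (m : nat) (f : R -> C) (Hf : Cm01 m f).

Lemma Derive01_n_correct (k : nat) (t : R) : (k < m)%nat -> I01 t ->
  is_derive01 (Derive01_n f k) t (Derive01_n f (S k) t).
Proof.
intros Hk Ht. destruct (proj1 Hf k t Hk Ht) as [l Hl].
replace (Derive01_n f (S k) t) with l; [exact Hl|].
symmetry. apply (Derive01_correct (Derive01_n f k) t l Ht Hl).
Qed.

Lemma Derive01_n_continuous (k : nat) : (k <= m)%nat ->
  continuous_on (U := C_R_NormedModule) I01 (Derive01_n f k).
Proof.
intros Hk. destruct (Nat.eq_dec k m) as [->|Hkm]; [apply Hf|].
intros t Ht.
apply (filterdiff_continuous_aux (U := R_NormedModule) (V := C_R_NormedModule)
  (F := within I01 (locally t)) (Derive01_n f k)).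
- eexists. apply (Derive01_n_correct k t); [lia|exact Ht].
- intros Pr HPr. apply filter_le_within. exact HPr.
Qed.

Lemma ex_RInt_periodize_Derive01_n (P : R -> R) (k p : nat) (x : R) :
  (k <= m)%nat -> (1 <= p)%nat -> 0 <= x <= 1 -> (forall t, continuous P t) ->
  ex_CRInt (fun t => (RtoC (periodize P (x - INR p * t)) * Derive01_n f k t)%C) 0 1.
Proof.
intros Hk Hp Hx HP.
apply (ex_RInt_ext (V := C_R_NormedModule)) with
  (2 := ex_RInt_periodize P (fun t => Derive01_n f k (clamp t)) p x Hp Hx HP
     (continuous_clamp _ (Derive01_n_continuous k Hk))).
rewrite Rmin_left, Rmax_right by lra. intros t Ht.
rewrite clamp_id by (unfold I01; lra). reflexivity.
Qed.

Variables (B : nat -> R -> R) (HB : is_bernoulli B).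

(** The last term carries the jump of the periodized [bern B (S k)] at the integers, which is
    nonzero only for [k = 0]. Integration by parts is applied to an extension [G], since it asks for
    two-sided derivatives. *)
Lemma RInt_periodize_step (k p : nat) (x : R) : (k < m)%nat -> (1 <= p)%nat -> 0 <= x <= 1 ->
  CRInt (fun t => RtoC (periodize (bern B (S k)) (x - INR p * t)) * Derive01_n f (S k) t)%C 0 1
  = (RtoC (INR p)
       * CRInt (fun t => RtoC (periodize (bern B k) (x - INR p * t)) * Derive01_n f k t) 0 1
     + RtoC (bern B (S k) x) * (Derive01_n f k 1 - Derive01_n f k 0)
     + RtoC (INR p) * RtoC (bern B (S k) 0 - bern B (S k) 1)%R * Hp p (Derive01_n f k) x)%C.
Proof.
intros Hk Hp1 Hx.
assert (Hp0 : 0 < INR p) by (apply lt_0_INR; lia).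
destruct (C1_extension (Derive01_n f k) (Derive01_n f (S k))) as [G [HG EG]].
{ intros t Ht. apply Derive01_n_correct; assumption. }
{ apply Derive01_n_continuous; lia. }
assert (D := is_RInt_parts (bern B (S k)) (bern B k) G _ p x Hp1 Hx
  (bern_derive B HB k) (bern_continuous B HB k) HG
  (continuous_clamp _ (Derive01_n_continuous (S k) Hk))).
assert (I := RInt_correct (V := C_R_CompleteNormedModule) _ _ _
  (ex_RInt_periodize_Derive01_n (bern B k) k p x ltac:(lia) Hp1 Hx (bern_continuous B HB k))).
assert (D2 := is_RInt_plus (V := C_R_NormedModule) _ _ _ _ _ _ D
  (is_RInt_scal (V := C_R_NormedModule) _ _ _ (INR p) _ I)).
apply (is_RInt_unique (V := C_R_CompleteNormedModule)). evar_last.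
- refine (is_RInt_ext (V := C_R_NormedModule) _ _ 0 1 _ _ D2).
  rewrite Rmin_left, Rmax_right by lra. intros t Ht.
  assert (It : I01 t) by (unfold I01; lra).
  rewrite scal_R_Cmult, (clamp_id t It), (EG t It), RtoC_mult.
  change (@plus (NormedModule.AbelianMonoid R_AbsRing C_R_NormedModule)) with Cplus.
  match goal with |- @eq _ ?y ?z => change (@eq C y z) end. ring.
- rewrite scal_R_Cmult, !EG by (unfold I01; lra).
  replace (Hp p G x) with (Hp p (Derive01_n f k) x).
  2: { unfold Hp. f_equal. apply sum_n_ext_loc. intros j Hj. symmetry. apply EG.
       assert (INR j + 1 <= INR p) by (rewrite <- S_INR; apply le_INR; lia).
       assert (Hj0 := pos_INR j).
       split.
       - apply Rmult_le_pos; [lra|left; apply Rinv_0_lt_compat, Hp0].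
       - apply Rmult_le_reg_r with (1 := Hp0).
         unfold Rdiv. rewrite Rmult_assoc, Rinv_l by lra. lra. }
  change (@plus (NormedModule.AbelianMonoid R_AbsRing C_R_NormedModule)) with Cplus.
  match goal with |- @eq _ ?y ?z => change (@eq C y z) end. unfold CRInt. ring.
Qed.

(** For [n = 1] the jump produces the Riemann sum, and [bern B 0 = 1] the integral of [f]. Each
    later integration by parts adds exactly the next term of the sum in [Eerr]. *)
Lemma Eerr_eq (n p : nat) (x : R) : (1 <= n <= m)%nat -> (1 <= p)%nat -> 0 <= x <= 1 ->
  Eerr B p n f x = (RtoC (1 / INR p ^ n)
    * CRInt (fun t => RtoC (periodize (bern B n) (x - INR p * t)) * Derive01_n f n t) 0 1)%C.
Proof.
intros Hn Hp1 Hx.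
assert (Hp0 : 0 < INR p) by (apply lt_0_INR; lia).
assert (Hc : RtoC (INR p) <> RtoC 0).
{ intro E. apply RtoC_inj in E. lra. }
assert (Hpow : forall n, RtoC (INR p ^ n) <> RtoC 0).
{ intros j E. apply RtoC_inj in E. apply (pow_nonzero (INR p) j); [lra|exact E]. }
assert (Hrec : forall k, RtoC (1 / INR p ^ k) = (RtoC 1 / RtoC (INR p ^ k))%C).
{ intros k. apply RtoC_div. apply pow_nonzero. lra. }
assert (HpS : forall k, RtoC (INR p ^ S k) = (RtoC (INR p) * RtoC (INR p ^ k))%C).
{ intros k. simpl. apply RtoC_mult. }
induction n as [|[|n] IH]; [lia| |].
- unfold Eerr. rewrite sum_n_n. rewrite (RInt_periodize_step 0 p x) by (lia || assumption).
  assert (E0 : CRInt (fun t => RtoC (periodize (bern B 0) (x - INR p * t)) * Derive01_n f 0 t)%C 0 1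
    = CRInt f 0 1).
  { apply (RInt_ext (V := C_R_CompleteNormedModule)). intros t _.
    unfold periodize. rewrite (bern_0 B HB). apply Cmult_1_l. }
  rewrite E0. replace (bern B 1 0 - bern B 1 1) with (- (1)) by (generalize (bern_1_ends B HB); lra).
  rewrite Hrec, HpS, RtoC_opp. simpl (INR p ^ 0). unfold bern. simpl (Derive01_n _ _).
  simpl (1 - 1)%nat. simpl (Derive01_n _ _). field. exact Hc.
- rewrite (RInt_periodize_step (S n) p x) by (lia || assumption).
  rewrite (bern_ends B HB (S (S n))), Rminus_diag by lia.
  specialize (IH ltac:(lia)).
  unfold Eerr in *. rewrite sum_n_Sm by lia.
  change (@plus C_AbelianMonoid) with Cplus. rewrite Cplus_assoc, IH.
  replace (S (S n) - 1)%nat with (S n) by lia.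
  rewrite !Hrec, (HpS (S n)). unfold bern at 3.
  field. split; [apply Hpow|exact Hc].
Qed.

End EulerMaclaurin.

Theorem theorem8p4 (B : nat -> R -> R) (HB : is_bernoulli B)
  (m : nat) (Hm : (1 <= m)%nat) (f : R -> C) (Hf : Cm01 m f)
  (x : R) (Hx : 0 <= x <= 1) :
  (forall p : nat, (1 <= p)%nat ->
     let g := fun t : R =>
       (RtoC (periodize (B m) (x - INR p * t) / INR (fact m)) * Derive01_n f m t)%C in
     ex_CRInt g 0 1 /\
     Eerr B p m f x = (RtoC (1 / INR p ^ m) * CRInt g 0 1)%C) /\
  (forall p : nat, (1 <= p)%nat ->
     Cmod (Eerr B p m f x) <=
       8 / PI * (1 / (2 * PI * INR p) ^ m) *
       sup01 (fun t => Cmod (Derive01_n f m t))) /\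
  filterlim (fun p : nat => (RtoC (INR p ^ m) * Eerr B p m f x)%C)
    eventually (locally (RtoC 0)).
Proof.
assert (Hc := continuous_clamp _ (Derive01_n_continuous m f Hf m (le_n m))).
split; [|split].
- intros p Hp g. split.
  + exact (ex_RInt_periodize_Derive01_n m f Hf (bern B m) m p x (le_n m) Hp Hx
      (bern_continuous B HB m)).
  + apply (Eerr_eq m f Hf B HB m p x); [lia|assumption|assumption].
- intros p Hp.
  assert (Hp0 : 0 < INR p) by (apply lt_0_INR; lia).
  assert (Pi0 := PI_RGT_0).
  rewrite (Eerr_eq m f Hf B HB m p x) by (lia || assumption).
  rewrite Cmod_mult, Cmod_R.
  assert (Hpp : 0 < / INR p ^ m) by (apply Rinv_0_lt_compat, pow_lt, Hp0).
  rewrite Rabs_pos_eq by (unfold Rdiv; lra).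
  set (S := sup01 _).
  (* By [energy_le], an upper bound for the L2 norm of [bern B m]. *)
  set (s := 8 / PI * (1 / (2 * PI) ^ m)).
  assert (Hs : 0 < s).
  { apply Rmult_lt_0_compat; apply Rdiv_lt_0_compat; try lra. apply pow_lt; lra. }
  destruct (bounded_continuity (V := C_R_NormedModule) _ 0 1 (fun t _ => Hc t)) as [M HM].
  replace (8 / PI * (1 / (2 * PI * INR p) ^ m) * S) with (1 / INR p ^ m * (S * s)).
  2: { unfold s. rewrite (Rpow_mult_distr (2 * PI) (INR p)). field.
       repeat split; try apply pow_nonzero; lra. }
  apply Rmult_le_compat_l; [unfold Rdiv; lra|].
  apply (Cmod_RInt_periodize_le (bern B m) (energy B m) (Derive01_n f m) p x s S _ Hp Hx Hs
    (bern_continuous B HB m) (energy_derive B HB m)).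
  + rewrite energy_0, Rminus_0_r. apply (energy_le B HB m Hm).
  + apply (sup01_ub (fun t => Cmod (Derive01_n f m t)) M).
    intros t Ht. left. generalize (HM t Ht). rewrite clamp_id by exact Ht.
    rewrite <- Cmod_norm. trivial.
  + apply (RInt_correct (V := C_R_CompleteNormedModule)).
    exact (ex_RInt_periodize_Derive01_n m f Hf (bern B m) m p x (le_n m) Hp Hx
      (bern_continuous B HB m)).
(* The primitive [bern B (S m)] agrees at 0 and 1 because its index is at least 2, that is,
   [bern B m] has mean zero. *)
- assert (L := filterlim_RInt_periodize (bern B (S m)) (bern B m) _ x Hx
    (bern_derive B HB m) (bern_continuous B HB m) (bern_ends B HB (S m) ltac:(lia)) Hc).
  refine (filterlim_ext_loc _ _ _ L). exists 1%nat. intros p Hp.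
  rewrite (Eerr_eq m f Hf B HB m p x) by (lia || assumption).
  assert (Hpp : INR p ^ m <> 0) by (apply pow_nonzero, not_0_INR; lia).
  rewrite Cmult_assoc, <- RtoC_mult.
  replace (INR p ^ m * (1 / INR p ^ m)) with 1 by (field; exact Hpp).
  rewrite Cmult_1_l.
  apply (RInt_ext (V := C_R_CompleteNormedModule)).
  rewrite Rmin_left, Rmax_right by lra. intros t Ht.
  rewrite clamp_id by (unfold I01; lra). reflexivity.
Qed.
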